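(* Let $K$ be an algebraically closed field complete with respect to a nontrivial nonarchimedean absolute value, let $\varphi:\mathbb{P}^N_K\to\mathbb{P}^N_K$ be a morphism of degree $d\ge2$, let $\Phi$ be a lift of $\varphi$, let $\hat g_\Phi$ be the modified Green function, and let $P\in\mathbb{P}^N(K)$. The following are equivalent: (a) $P\in\mathcal{F}(\varphi)$, i.e. the iterates of $\varphi$ are equicontinuous at every point of some neighborhood of $P$; (b) the iterates of $\varphi$ are locally uniformly Lipschitz at $P$, i.e. there exist $r>0$ and $C>0$ with $\Delta(\varphi^n(Q),\varphi^n(R))\le C\,\Delta(Q,R)$ for all $Q,R\in\bar D_r(P)$ and all $n\ge0$; (c) $\hat g_\Phi$ is constant on a neighborhood of $P$.
   Context: For $x\in K^{N+1}$, $\|x\|=\max_i|x_i|$, and $\pi:K^{N+1}\setminus\{0\}\to\mathbb{P}^N(K)$ is the projection. The chordal distance of $P=\pi(x)$, $Q=\pi(y)$ is $\Delta(P,Q)=\max_{i,j}|x_iy_j-x_jy_i|/(\|x\|\,\|y\|)$, and $\bar D_r(P)=\{Q:\Delta(P,Q)\le r\}$. A lift of $\varphi$ is a tuple $\Phi=(\Phi_0,\dots,\Phi_N)$ of degree-$d$ homogeneous polynomials over $K$ with no common nontrivial zero and $\varphi\circ\pi=\pi\circ\Phi$. The Green function is $G_\Phi(x)=\lim_{n\to\infty}d^{-n}\log\|\Phi^n(x)\|$ (the limit exists) and $\hat g_\Phi(P)=G_\Phi(x)-\log\|x\|$ for $x\in\pi^{-1}(P)$. A family of maps is equicontinuous at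 $P$ if for every $\epsilon>0$ there is $\delta>0$ with $\Delta(\psi(P),\psi(Q))<\epsilon$ whenever $\Delta(P,Q)<\delta$, for all $\psi$ in the family. The Fatou set $\mathcal{F}(\varphi)$ is the union of all open sets $U\subseteq\mathbb{P}^N(K)$ such that $\{\varphi^n\}_{n\ge1}$ is equicontinuous at every point of $U$. *)

(* Defs.v *)
From HB Require Import structures.
From mathcomp Require Import all_boot all_order all_algebra.
From mathcomp Require Import all_classical all_reals all_analysis.
From mathcomp Require mpoly.
Set Implicit Arguments. Unset Strict Implicit. Unset Printing Implicit Defensive.
Import Order.TTheory GRing.Theory Num.Theory.
Import numFieldNormedType.Exports.
Local Open Scope ring_scope.

Section Defs.
Variables (R : realType) (K : closedFieldType) (absv : K -> R).

Definition nonarch_abs : Prop :=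
  [/\ forall x, 0 <= absv x,
      forall x, absv x = 0 <-> x = 0,
      forall x y, absv (x * y) = absv x * absv y &
      forall x y, absv (x + y) <= Num.max (absv x) (absv y)].

Definition nontrivial_abs : Prop := exists x : K, absv x != 0 /\ absv x != 1.

Definition complete_abs : Prop :=
  forall u : nat -> K,
    (forall e : R, 0 < e -> exists M : nat, forall m n : nat,
        (M <= m)%N -> (M <= n)%N -> absv (u m - u n) < e) ->
    exists l : K, forall e : R, 0 < e -> exists M : nat, forall n : nat,
        (M <= n)%N -> absv (u n - l) < e.

Definition nonarch_complete_field : Prop :=
  [/\ nonarch_abs, nontrivial_abs & complete_abs].

Variable N : nat.
Definition vec := 'I_N.+1 -> K.

Definition nonzero (x : vec) : Prop := exists i, x i != 0.

Definition vnorm (x : vec) : R := \big[Num.max/0]_(i < N.+1) absv (x i).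

(* chordal distance of pi(x), pi(y), computed on representatives *)
Definition chordal (x y : vec) : R :=
  (\big[Num.max/0]_(i < N.+1) \big[Num.max/0]_(j < N.+1)
      absv (x i * y j - x j * y i)) / (vnorm x * vnorm y).

Definition homog_deg (d : nat) (p : mpoly.mpoly N.+1 K) : Prop :=
  all (fun m : mpoly.multinom N.+1 => mpoly.mdeg m == d) (mpoly.msupp p).

Definition is_lift (d : nat) (Phi : 'I_N.+1 -> mpoly.mpoly N.+1 K) : Prop :=
  (forall i, homog_deg d (Phi i)) /\
  (forall x : vec, (forall i, mpoly.meval x (Phi i) = 0) -> forall i, x i = 0).

Definition evalPhi (Phi : 'I_N.+1 -> mpoly.mpoly N.+1 K) (x : vec) : vec :=
  fun i => mpoly.meval x (Phi i).

Definition iterPhi Phi (n : nat) (x : vec) : vec := iter n (evalPhi Phi) x.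

Definition chordal_open (U : vec -> Prop) : Prop :=
  forall y, nonzero y -> U y -> exists r : R, 0 < r /\
    forall z, nonzero z -> chordal y z < r -> U z.

Definition equicont_at Phi (y : vec) : Prop :=
  forall e : R, 0 < e -> exists delta : R, 0 < delta /\
    forall z, nonzero z -> chordal y z < delta ->
      forall n : nat, (1 <= n)%N ->
        chordal (iterPhi Phi n y) (iterPhi Phi n z) < e.

Definition in_fatou Phi (x : vec) : Prop :=
  exists U : vec -> Prop, [/\ chordal_open U, U x &
    forall y, nonzero y -> U y -> equicont_at Phi y].

Definition loc_unif_lipschitz Phi (x : vec) : Prop :=
  exists r C : R, [/\ 0 < r, 0 < C &
    forall y z, nonzero y -> nonzero z -> chordal x y <= r -> chordal x z <= r ->
      forall n : nat,
        chordal (iterPhi Phi n y) (iterPhi Phi n z) <= C * chordal y z].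

Definition green (d : nat) Phi (x : vec) : R :=
  limn (fun n : nat => ln (vnorm (iterPhi Phi n x)) / (d%:R ^+ n)).

Definition ghat (d : nat) Phi (x : vec) : R := green d Phi x - ln (vnorm x).

Definition ghat_loc_const (d : nat) Phi (x : vec) : Prop :=
  exists U : vec -> Prop, [/\ chordal_open U, U x &
    forall y, nonzero y -> U y -> ghat d Phi y = ghat d Phi x].

End Defs.

(* Main.v *)
(* All estimates come from [Phi] having good size: the Nullstellensatz gives
   [c |x|^d <= |Phi x| <= C |x|^d], so [ln |Phi^n x|] stays within a bounded distance of
   [d^n G(x)], and [|Phi x| / |x|^d] is locally constant at a uniform scale.
   If the iterates are equicontinuous at [P], the orbits of nearby points stay within that
   scale, so all terms of the telescoping series for [ghat] agree: [ghat] is constant near [P].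
   If [ghat] is constant near [P], then on a polydisc in an affine chart [|Phi^n|] is, up to a
   factor independent of [n], equal to a constant [M_n]; the nonarchimedean Schwarz lemma makes
   [Phi^n] Lipschitz with constant [O(M_n)], and dividing by [|Phi^n| ~ M_n] gives a chordal
   Lipschitz constant independent of [n].
   Since [K] is uncountable (it is complete), the Nullstellensatz has a short proof by counting
   dimensions: see [proper_ideal_extend]. *)

Require Import Defs.
From HB Require Import structures.
From mathcomp Require Import all_boot all_order all_algebra.
From mathcomp Require Import all_classical all_reals all_analysis.
From mathcomp Require mpoly.
From mathcomp Require Import ring lra.
Import -(notations) mpoly.
Import Order.TTheory GRing.Theory Num.Theory.
Import numFieldNormedType.Exports.
Local Open Scope classical_set_scope.
Local Open Scope ring_scope.
Set Implicit Arguments. Unset Strict Implicit. Unset Printing Implicit Defensive.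

(** * Ultrametric absolute values and a Baire category argument *)

Section Ultrametric.
Variables (R : realType) (K : closedFieldType) (absv : K -> R).
Hypothesis abs : nonarch_abs absv.

Lemma absv_ge0 a : 0 <= absv a. Proof. by have [] := abs. Qed.

Lemma absv0P a : absv a = 0 <-> a = 0. Proof. by have [_ h _ _] := abs. Qed.

Lemma absvM a b : absv (a * b) = absv a * absv b.
Proof. by have [_ _ h _] := abs. Qed.

Lemma absvD a b : absv (a + b) <= Num.max (absv a) (absv b).
Proof. by have [_ _ _ h] := abs. Qed.

Lemma absv0 : absv 0 = 0. Proof. exact/absv0P. Qed.

Lemma absv_eq0 a : (absv a == 0) = (a == 0).
Proof. by apply/eqP/eqP => /absv0P. Qed.

Lemma absv_gt0 a : (0 < absv a) = (a != 0).
Proof. by rewrite lt_neqAle absv_ge0 andbT eq_sym absv_eq0. Qed.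

Lemma absv1 : absv 1 = 1.
Proof.
have h : absv 1 != 0 by rewrite absv_eq0 oner_eq0.
by apply: (mulfI h); rewrite -absvM !mulr1.
Qed.

Lemma absvN a : absv (- a) = absv a.
Proof.
have h : absv (-1) = 1.
  apply: (@pexpIrn _ 2) => //; rewrite ?nnegrE ?absv_ge0 ?ler01 //.
  by rewrite expr1n expr2 -absvM mulrNN mulr1 absv1.
by rewrite -mulN1r absvM h mul1r.
Qed.

Lemma absvBC a b : absv (a - b) = absv (b - a).
Proof. by rewrite -opprB absvN. Qed.

Lemma absvV a : absv a^-1 = (absv a)^-1.
Proof.
have [->|a0] := eqVneq a 0; first by rewrite invr0 absv0 invr0.
have h : absv a != 0 by rewrite absv_eq0.
by apply: (mulfI h); rewrite -absvM !divff // absv1.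
Qed.

Lemma absvX a n : absv (a ^+ n) = absv a ^+ n.
Proof. by elim: n => [|n IH]; rewrite ?expr0 ?absv1 // !exprS absvM IH. Qed.

Lemma absvD_le a b B : absv a <= B -> absv b <= B -> absv (a + b) <= B.
Proof. by move=> ha hb; rewrite (le_trans (absvD _ _)) // ge_max ha. Qed.

Lemma absvB_le a b B : absv a <= B -> absv b <= B -> absv (a - b) <= B.
Proof. by move=> ha hb; apply: absvD_le; rewrite ?absvN. Qed.

Lemma absvD_lt a b B : absv a < B -> absv b < B -> absv (a + b) < B.
Proof. by move=> ha hb; rewrite (le_lt_trans (absvD _ _)) // gt_max ha. Qed.

Lemma absvB_lt a b B : absv a < B -> absv b < B -> absv (a - b) < B.
Proof. by move=> ha hb; apply: absvD_lt; rewrite ?absvN. Qed.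

(** Otherwise [b = (a + b) - a] would be a difference of two elements smaller than [b]. *)
Lemma absvD_eqr a b : absv a < absv b -> absv (a + b) = absv b.
Proof.
move=> ab; apply/eqP; rewrite eq_le absvD_le ?(ltW ab) //=.
rewrite leNgt; apply/negP => h.
by have := absvB_lt h ab; rewrite addrAC subrr add0r ltxx.
Qed.

Lemma absv_sum_le (I : Type) (s : seq I) (P : pred I) (F : I -> K) (B : R) :
  0 <= B -> (forall i, P i -> absv (F i) <= B) ->
  absv (\sum_(i <- s | P i) F i) <= B.
Proof.
move=> B0 h; elim/big_rec: _ => [|i x Pi hx]; first by rewrite absv0.
by apply: absvD_le => //; apply: h.
Qed.

Lemma absv_prod (I : Type) (s : seq I) (P : pred I) (F : I -> K) :
  absv (\prod_(i <- s | P i) F i) = \prod_(i <- s | P i) absv (F i).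
Proof. by apply: (big_morph absv absvM absv1). Qed.

Hypothesis ntriv : nontrivial_abs absv.

(** An element of absolute value other than 0 and 1, or its inverse, has absolute value below 1, and
    its powers tend to 0. *)
Lemma absv_small (e : R) : 0 < e -> exists2 a : K, a != 0 & absv a < e.
Proof.
move=> e0.
have [p p0 p1] : exists2 a : K, a != 0 & absv a < 1.
  case: ntriv => a []; rewrite absv_eq0 => a0 a1.
  have [lt1|ge1] := ltP (absv a) 1; first by exists a.
  exists a^-1; rewrite ?invr_eq0 // absvV invf_lt1 ?absv_gt0 //.
  by rewrite lt_neqAle eq_sym a1.
have /cvgrPdist_lt /(_ e e0) [n _ /(_ n (leqnn n))] : (fun n => absv p ^+ n) @ \oo --> (0 : R).
  by apply: cvg_expr; rewrite ger0_norm ?absv_ge0.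
rewrite /= sub0r normrN ger0_norm ?exprn_ge0 ?absv_ge0 // -absvX => h.
by exists (p ^+ n); rewrite ?expf_neq0.
Qed.

(** One step of the nested-ball construction: the closed ball of center [v] and radius [t] misses
    [s], and halving makes the radii tend to 0. *)
Lemma avoid_seq (s : seq K) (u : K) (r : R) : 0 < r ->
  exists v : K, exists t : R, [/\ absv (v - u) <= r, 0 < t, t <= r / 2 &
    forall c, c \in s -> t < absv (c - v)].
Proof.
move=> r0; elim: s => [|c s [v [t [vu t0 tr hs]]]].
  by exists u, (r / 2); split => //; rewrite ?subrr ?absv0 ?ltW ?divr_gt0.
(* If [c] is not the center, a smaller radius suffices. Otherwise the center moves by some [a]
   smaller than [t], which leaves its distance to the other elements unchanged. *)
have [->|cv] := eqVneq c v; last first.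
  have c0 : 0 < absv (c - v) by rewrite absv_gt0 subr_eq0.
  exists v, (Num.min t (absv (c - v) / 2)); split => //.
  - by rewrite lt_min t0 divr_gt0.
  - by rewrite ge_min tr.
  - move=> e; rewrite inE => /orP[/eqP ->|/hs h]; rewrite gt_min ?h //.
    by apply/orP; right; rewrite ltr_pdivrMr // ltr_pMr // ltr1n.
have [a a0 at_] := absv_small t0.
have a0' : 0 < absv a by rewrite absv_gt0.
exists (v + a), (absv a / 2); split.
- rewrite addrAC; apply: absvD_le => //.
  by rewrite (le_trans (ltW at_)) // (le_trans tr) // ler_pdivrMr // ler_pMr // ler1n.
- by rewrite divr_gt0.
- by rewrite ler_pM2r ?invr_gt0 // (le_trans (ltW at_)) // (le_trans tr) // ler_pdivrMr // ler_pMr // ler1n.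
- have half : absv a / 2 < absv a by rewrite ltr_pdivrMr // ltr_pMr // ltr1n.
  move=> e; rewrite inE => /orP[/eqP ->|/hs h].
    by rewrite opprD addrA subrr add0r absvN.
  rewrite opprD addrA addrC absvD_eqr ?absvN; last exact: lt_trans h.
  by apply: lt_trans h; apply: lt_trans at_.
Qed.

Hypothesis compl : complete_abs absv.

(* Baire category: nested balls avoid countably many finite sets. *)
Lemma infinite_in_countable_cover (S : nat -> K -> Prop) :
  (forall c, exists D, S D c) ->
  exists D, forall s : seq K, exists2 c, S D c & c \notin s.
Proof.
move=> cover; apply: contrapT => no.
have [s hs] : {s : nat -> seq K & forall D c, S D c -> c \in s D}.
  apply: (@choice _ _ (fun D t => forall c, S D c -> c \in t)) => D.
  apply: contrapT => noD; apply: no; exists D => t; apply: contrapT => h.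
  apply: noD; exists t => c Sc; apply: contrapT => /negP ct.
  by apply: h; exists c.
have [f hf] : {f : nat * (K * R) -> K * R & forall w,
    0 < w.2.2 -> [/\ absv ((f w).1 - w.2.1) <= w.2.2, 0 < (f w).2,
      (f w).2 <= w.2.2 / 2 & forall c, c \in s w.1 -> (f w).2 < absv (c - (f w).1)]}.
  apply: (@choice _ _ (fun (w : nat * (K * R)) (z : K * R) =>
    0 < w.2.2 -> [/\ absv (z.1 - w.2.1) <= w.2.2, 0 < z.2,
      z.2 <= w.2.2 / 2 & forall c, c \in s w.1 -> z.2 < absv (c - z.1)])) => w.
  have [w0|w0] := ltP 0 w.2.2; last by exists (0, 0).
  have [v [t h]] := avoid_seq (s w.1) w.2.1 w0.
  by exists (v, t).
(* [b n] is the [n]-th ball as a pair of center and radius; its successor has its center in it and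
   avoids [s n]. *)
pose b := fix b n := if n is m.+1 then f (m, b m) else (0, 1) : K * R.
have b0 n : 0 < (b n).2.
  by elim: n => [|n IH] /=; [exact: ltr01 | have [] := hf (n, b n) IH].
have bS n : [/\ absv ((b n.+1).1 - (b n).1) <= (b n).2,
      (b n.+1).2 <= (b n).2 / 2 & forall c, c \in s n -> (b n.+1).2 < absv (c - (b n.+1).1)].
  by have [? ? ? ?] := hf (n, b n) (b0 n); split.
have mono m k : (b (m + k)%N).2 <= (b m).2.
  elim: k => [|k IH]; first by rewrite addn0.
  rewrite addnS; have [_ h _] := bS (m + k)%N.
  by rewrite (le_trans h) // (le_trans _ IH) // ler_pdivrMr // ler_pMr // ler1n.
have near m k : absv ((b (m + k)%N).1 - (b m).1) <= (b m).2.
  elim: k => [|k IH]; first by rewrite addn0 subrr absv0 ltW.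
  rewrite addnS; have [h _ _] := bS (m + k)%N.
  rewrite -(subrK (b (m + k)%N).1 (b (m + k).+1).1) -addrA.
  by apply: absvD_le => //; rewrite (le_trans h).
have small n : (b n).2 <= (2^-1) ^+ n.
  elim: n => [|n IH]; first by rewrite expr0.
  have [_ h _] := bS n; rewrite (le_trans h) // exprSr.
  by rewrite ler_pM2r // invr_gt0.
have small_e e : 0 < e -> exists M, (b M).2 < e.
  move=> e0.
  have /cvgrPdist_lt /(_ e e0) [n _ /(_ n (leqnn n))] : (fun n => (2^-1 : R) ^+ n) @ \oo --> (0 : R).
    by apply: cvg_expr; rewrite ger0_norm ?invr_ge0 // invf_lt1 // ltr1n.
  rewrite /= sub0r normrN ger0_norm ?exprn_ge0 ?invr_ge0 // => h.
  by exists n; rewrite (le_lt_trans (small n)).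
have [l hl] : exists l : K, forall e : R, 0 < e -> exists M : nat, forall n : nat,
    (M <= n)%N -> absv ((b n).1 - l) < e.
  apply: compl => e /small_e [M hM]; exists M => m n Mm Mn.
  have := near M (m - M)%N; have := near M (n - M)%N.
  rewrite !subnKC // => h1 h2.
  rewrite (le_lt_trans _ hM) // -(subrK (b M).1 (b m).1) -addrA.
  by apply: absvD_le => //; rewrite absvBC.
(* The limit [l] lies in the list [s D], which the ball [b D.+1] avoids; but [l] belongs to that
   closed ball. *)
have [D SD] := cover l.
have [_ _ /(_ l (hs _ _ SD))] := bS D; rewrite ltNge => /negP; apply.
have [M hM] := hl _ (b0 D.+1).
have := hM (D.+1 + M)%N (leq_addl _ _) => h.
rewrite -(subrK (b (D.+1 + M)%N).1 l) -addrA.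
apply: absvD_le; last exact: near.
by rewrite absvBC ltW.
Qed.

End Ultrametric.

(** * Weak Nullstellensatz over an uncountable algebraically closed field *)

Section Nullstellensatz.
Variables (K : closedFieldType) (n : nat).
Hypothesis uncountableK : forall S : nat -> K -> Prop,
  (forall c, exists D, S D c) ->
  exists D, forall s : seq K, exists2 c, S D c & c \notin s.

Local Notation A := (mpoly n K).

Definition ideal_pred (I : A -> Prop) : Prop :=
  [/\ I 0, forall p q, I p -> I q -> I (p + q) & forall p q, I q -> I (p * q)].

Lemma ideal_pred_sum I (T : Type) (s : seq T) (F : T -> A) :
  ideal_pred I -> (forall t, I (F t)) -> I (\sum_(t <- s) F t).
Proof. by case=> I0 ID _ h; elim/big_rec: _ => [//|t p _]; apply: ID. Qed.

(** For a nonzero polynomial [mmeasure mdeg] is the total degree plus one, so only the monomials of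
    degree below [D], those of [bmultinom n D], occur. With more polynomials than monomials, the
    coefficient matrix has a nonzero left kernel. *)
Lemma dependent_of_msize_le (D m : nat) (g : 'I_m -> A) :
  (#|{: bmultinom n D}| < m)%N -> (forall k, (mmeasure (@mdeg n) (g k) <= D)%N) ->
  exists2 v : 'I_m -> K, exists k, v k != 0 & \sum_k v k *: g k = 0.
Proof.
move=> hm hg.
pose M := \matrix_(k < m, j < #|{: bmultinom n D}|) mcoeff (bmnm (enum_val j)) (g k).
have : kermx M != 0.
  rewrite kermx_eq0 /row_free; apply: contraTneq hm => <-.
  by rewrite -leqNgt rank_leq_col.
case/matrix0Pn => i [k hk]; exists (fun k => kermx M i k); first by exists k.
apply/mpolyP => u; rewrite raddf_sum mcoeff0 /=.
have [uD|uD] := ltnP (mdeg u) D; last first.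
  apply: big1 => j _; rewrite mcoeffZ (memN_msupp_eq0 (p := g j)) ?mulr0 //.
  by apply: msize_mdeg_ge; apply: leq_trans uD.
have /matrixP /(_ i (enum_rank (BMultinom uD))) := mulmx_ker M.
rewrite mxE [in X in _ = X -> _]mxE => hu; rewrite -[RHS]hu.
apply: eq_bigr => j _.
by rewrite mcoeffZ [M _ _]mxE enum_rankK.
Qed.

(* If no such [c] existed, [p - c] would be invertible modulo [I] for uncountably many [c]; the
   inverses would satisfy a linear relation (finitely many degrees), which after clearing
   denominators puts a nonzero polynomial in [p], hence a product of [p - e]'s, in [I]. *)
Lemma proper_ideal_extend (I : A -> Prop) (p : A) :
  ideal_pred I -> ~ I 1 ->
  exists c : K, forall a : A, ~ I (1 - a * (p - c%:A)).
Proof.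
move=> idI I1; have [I0 ID IM] := idI.
apply: contrapT => no.
have [g hg] : {g : K -> A & forall c, I (1 - g c * (p - c%:A))}.
  apply: (@choice _ _ (fun c (a : A) => I (1 - a * (p - c%:A)))) => c.
  apply: contrapT => h; apply: no; exists c => a Ia.
  by apply: h; exists a.
have [D hD] := @uncountableK (fun D c => (mmeasure (@mdeg n) (g c) <= D)%N)
  (fun c => ex_intro _ (mmeasure (@mdeg n) (g c)) (leqnn _)).
have [s [us ss hs]] : exists s : seq K, [/\ uniq s, size s = #|{: bmultinom n D}|.+1 &
    forall c, c \in s -> (mmeasure (@mdeg n) (g c) <= D)%N].
  elim: #|_|.+1 => [|m [s [us ss hs]]]; first by exists [::].
  have [c hc cs] := hD s; exists (c :: s); split; rewrite /= ?cs ?ss //.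
  by move=> e; rewrite inE => /orP[/eqP ->|/hs].
pose c (k : 'I_(#|{: bmultinom n D}|.+1)) := s`_k.
have cs k : c k \in s by rewrite mem_nth // ss.
have cinj k l : k != l -> c k != c l by rewrite /c nth_uniq // ss.
have [v [k0 vk0] hv] := @dependent_of_msize_le D _ (fun k => g (c k)) (ltnSn _)
  (fun k => hs _ (cs k)).
(* [h] comes from the relation [hv] by replacing [g (c k)] with the inverse of [X - c k] and
   clearing denominators. At [c k0] only the term [k0] survives, so [h] is nonzero. *)
pose h : {poly K} := \sum_k v k *: \prod_(l | l != k) ('X - (c l)%:P).
have h0 : h != 0.
  apply/eqP => /(congr1 (fun q => q.[c k0])); rewrite horner0 horner_sum.
  rewrite (bigD1 k0) //= [X in _ + X]big1 ?addr0; last first.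
    move=> k kk; rewrite hornerZ horner_prod (bigD1 k0) 1?eq_sym //=.
    by rewrite hornerXsubC subrr mul0r mulr0.
  rewrite hornerZ horner_prod; apply/eqP; rewrite mulf_neq0 //.
  by apply/prodf_neq0 => l lk; rewrite hornerXsubC subr_eq0 cinj // eq_sym.
have Ih : I (horner_alg p h).
  have eX e : horner_alg p ('X - e%:P) = p - e%:A.
    by rewrite rmorphB /= horner_algX horner_algC.
  (* Adding [hv] times the full product, which is zero, exhibits each summand as a multiple of an
     element of [I]. *)
  have -> : horner_alg p h = \sum_k (v k *: \prod_(l | l != k) (p - (c l)%:A))
      * (1 - g (c k) * (p - (c k)%:A)).
    have := congr1 (fun q => q * \prod_l (p - (c l)%:A)) hv.
    rewrite /= mul0r mulr_suml => hv'.
    rewrite -[RHS]addr0 -[X in _ = _ + X]hv'.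
    rewrite -big_split rmorph_sum; apply: eq_bigr => k _ /=.
    rewrite [X in _ = _ + _ * X](bigD1 k) //= linearZ rmorph_prod /=.
    rewrite (eq_bigr (fun l => p - (c l)%:A)) => [|l _]; last exact: eX.
    by rewrite -!scalerAl; rewrite -scalerDr; congr (_ *: _); ring.
  by apply: ideal_pred_sum => // k; apply: IM.
have [r hr] := closed_field_poly_normal h.
apply: I1; move: Ih; rewrite hr linearZ /= rmorph_prod /= => Ih.
have {Ih} : I ((\prod_(z <- r) horner_alg p ('X - z%:P)) * 1).
  have /(IM (lead_coef h)^-1%:A) := Ih.
  by rewrite !mulr_algl scalerA mulVf ?lead_coef_eq0 // scale1r mulr1.
(* Modulo [I] each factor [p - e] has the inverse [g e], so the factors cancel one at a time. *)
have red q : I ((\prod_(z <- r) horner_alg p ('X - z%:P)) * q) -> I q; last exact: red.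
elim: r {hr} q => [|e r IH] q; first by rewrite big_nil mul1r.
rewrite big_cons [_ * \prod_(_ <- _) _]mulrC -mulrA => /IH.
rewrite rmorphB /= horner_algX horner_algC => Iq.
have -> : q = q * (1 - g e * (p - e%:A)) + g e * ((p - e%:A) * q) by ring.
by apply: ID; apply: IM.
Qed.

(** If the ideal of the [f t] were proper, it could be enlarged by some [X_i - c] for one variable
    after another while staying proper. Modulo the result every polynomial equals its value at the
    point [x] so found, hence every [f t] vanishes at [x]. *)
Lemma weak_nullstellensatz (T : finType) (f : T -> A) :
  (forall x : 'I_n -> K, exists t, meval x (f t) != 0) ->
  exists a : T -> A, \sum_t a t * f t = 1.
Proof.
move=> nozero; apply: contrapT => no.
pose I0 (q : A) := exists a : T -> A, q = \sum_t a t * f t.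
have idI0 : ideal_pred I0.
  split.
  - by exists (fun=> 0); rewrite big1 // => t _; rewrite mul0r.
  - move=> _ _ [a ->] [b ->]; exists (fun t => a t + b t).
    by rewrite -big_split; apply: eq_bigr => t _; rewrite mulrDl.
  - move=> p _ [a ->]; exists (fun t => p * a t).
    by rewrite mulr_sumr; apply: eq_bigr => t _; rewrite mulrA.
have [I [x [idI I1 If Ix]]] : exists (I : A -> Prop) (x : 'I_n -> K),
    [/\ ideal_pred I, ~ I 1, forall t, I (f t) &
      forall i, i \in enum 'I_n -> I (mpolyX K (mnm1 i) - (x i)%:A)].
  elim: (enum 'I_n) => [|i s [I [x [idI I1 If Ix]]]].
    exists I0, (fun=> 0); split => //; first by case=> a h; apply: no; exists a.
    move=> t; exists (fun u => (u == t)%:R); rewrite (bigD1 t) //= eqxx mul1r.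
    by rewrite big1 ?addr0 // => u /negPf ->; rewrite mul0r.
  have [J0 JD JM] := idI.
  have [c hc] := proper_ideal_extend (mpolyX K (mnm1 i)) idI I1.
  pose w : A := mpolyX K (mnm1 i) - c%:A.
  have sub q : I q -> exists a, I (q - a * w) by exists 0; rewrite mul0r subr0.
  (* This is the ideal generated by [I] and [w]; the choice of [c] says exactly that it omits 1. *)
  exists (fun q => exists a, I (q - a * w)), (fun j => if j == i then c else x j); split.
  - split; first exact: sub.
    + move=> p q [a ha] [b hb]; exists (a + b).
      by rewrite (_ : _ - _ = (p - a * w) + (q - b * w)); [exact: JD | ring].
    + move=> p q [a ha]; exists (p * a).
      by rewrite (_ : _ - _ = p * (q - a * w)); [exact: JM | ring].
  - by case=> a; apply: hc.
  - by move=> t; apply: sub.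
  - move=> j; rewrite inE; case: eqVneq => [-> _|_ /= /Ix]; last exact: sub.
    by exists 1; rewrite mul1r subrr.
have [J0 JD JM] := idI.
have evalI p : I (p - (meval x p)%:A).
  have QM q r : I (q - (meval x q)%:A) -> I (r - (meval x r)%:A) ->
      I (q * r - (meval x (q * r))%:A).
    move=> hq hr; rewrite mevalM -scalerA -[_ *: (_)%:A]mulr_algl.
    rewrite (_ : _ - _ = q * (r - (meval x r)%:A) + (meval x r)%:A * (q - (meval x q)%:A)).
      by apply: JD; apply: JM.
    by ring.
  have Q1 : I (1 - (meval x (1 : A))%:A) by rewrite meval1 scale1r subrr.
  have QXn i k : I (mpolyX K (mnm1 i) ^+ k - (meval x (mpolyX K (mnm1 i) ^+ k))%:A).
    elim: k => [|k IH]; first exact: Q1.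
    have Xi : I (mpolyX K (mnm1 i) - (meval x (mpolyX K (mnm1 i)))%:A).
      by rewrite mevalXU; apply: Ix; rewrite mem_enum.
    by rewrite exprS; apply: QM Xi IH.
  have QX m : I (mpolyX K m - (meval x (mpolyX K m))%:A).
    rewrite mpolyXE_id; elim/big_rec: _ => [|i q _ hq]; first exact: Q1.
    exact: QM (QXn i (m i)) hq.
  rewrite {1 2}(mpolyE p) raddf_sum scaler_suml -sumrB /=.
  apply: ideal_pred_sum => // m; rewrite mevalZ -scalerA -scalerBr.
  by rewrite -mul_mpolyC; apply: JM.
have [t ft] := nozero x; apply: I1.
rewrite (_ : 1 = (meval x (f t))^-1%:A * (f t + (-1) * (f t - (meval x (f t))%:A))).
  by apply/JM/JD => //; apply: JM.
by rewrite mulN1r opprB addrC subrK mulr_algl scalerA mulVf // scale1r.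
Qed.

End Nullstellensatz.

(** * The Gauss norm and Schwarz's lemma in one variable *)

Section GaussNorm.
Variables (R : realType) (K : closedFieldType) (absv : K -> R).
Hypothesis abs : nonarch_abs absv.

(** [Num.max 1 (absv a)] is the Gauss norm of [X - a], and the Gauss norm is submultiplicative. *)
Lemma coef_prod_XsubC_le (r : seq K) k :
  absv (\prod_(a <- r) ('X - a%:P))`_k <= \prod_(a <- r) Num.max 1 (absv a).
Proof.
have M0 (s : seq K) : 0 <= \prod_(a <- s) Num.max 1 (absv a).
  by apply: prodr_ge0 => a _; rewrite le_max ler01.
elim: r k => [|a r IH] k.
  by rewrite !big_nil coef1; case: k => [|k]; rewrite ?(absv1 abs) ?(absv0 abs) ?ler01.
rewrite !big_cons mulrBl coefB coefXM coefCM; apply: (absvB_le abs).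
  case: k => [|k] /=; first by rewrite (absv0 abs) mulr_ge0 // le_max ler01.
  by rewrite (le_trans (IH k)) // ler_peMl // le_max lexx.
by rewrite (absvM abs) ler_pM ?(absv_ge0 abs) // le_max lexx orbT.
Qed.

(* The residue field is infinite: a root of [prod (X - a) - 1] reduces to none of the [a]. *)
Lemma residue_avoid (r : seq K) : all (fun a => absv a <= 1) r ->
  exists2 t : K, absv t <= 1 & forall a, a \in r -> absv (t - a) = 1.
Proof.
case: r => [|b r] hr; first by exists 0; rewrite // (absv0 abs) ler01.
set s := b :: r in hr *.
have [t] : exists t, root (\prod_(a <- s) ('X - a%:P) - 1) t.
  apply/closed_rootP; rewrite size_polyDl ?size_prod_XsubC //.
  by rewrite size_polyN size_poly1.
rewrite rootE hornerD hornerN hornerC subr_eq0 horner_prod => /eqP ht.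
have hp : \prod_(a <- s) absv (t - a) = 1.
  have := congr1 absv ht; rewrite (absv1 abs) (absv_prod abs); apply: etrans.
  by apply: eq_bigr => a _; rewrite hornerXsubC.
have t1 : absv t <= 1.
  rewrite leNgt; apply/negP => t1.
  have : 1 < \prod_(a <- s) absv (t - a).
    rewrite (eq_big_seq (fun=> absv t)) => [|a /(allP hr) a1].
      by rewrite big_const_seq count_predT iter_mulr_1 exprn_egt1.
    by rewrite addrC (absvD_eqr abs) // (absvN abs); apply: le_lt_trans t1.
  by rewrite hp ltxx.
exists t => // a ar; apply/eqP; rewrite eq_le; apply/andP; split.
  by apply: (absvB_le abs) => //; apply: (allP hr).
(* The factors have absolute value at most 1 and their product has absolute value 1, so none is
   smaller. *)
rewrite -{1}hp (big_rem a) //= ler_piMr ?(absv_ge0 abs) //.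
rewrite big_seq; apply: prodr_ile1 => c cr; rewrite (absv_ge0 abs) /=.
by apply: (absvB_le abs) => //; apply: (allP hr); apply: (mem_subseq (rem_subseq a s)) cr.
Qed.

(** Maximum principle: at a point [t] of the unit disc at distance 1 from every root in that disc,
    each factor [t - a] attains the Gauss norm of [X - a]. *)
Lemma coef_le_of_bounded (f : {poly K}) (M : R) :
  (forall t, absv t <= 1 -> absv f.[t] <= M) -> forall k, absv f`_k <= M.
Proof.
move=> hf k; have [r hr] := closed_field_poly_normal f.
have [t t1 ht] := @residue_avoid [seq a <- r | absv a <= 1] (filter_all _ _).
apply: le_trans (hf t t1).
rewrite {1}hr coefZ {2}hr hornerZ !(absvM abs) ler_wpM2l ?(absv_ge0 abs) //.
rewrite (le_trans (coef_prod_XsubC_le r k)) // horner_prod (absv_prod abs).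
rewrite le_eqVlt; apply/orP; left; apply/eqP.
apply: eq_big_seq => a ar; rewrite hornerXsubC.
have [a1|a1] := leP (absv a) 1.
  by rewrite ht ?mem_filter ?a1.
rewrite (absvD_eqr abs) ?(absvN abs) //.
exact: le_lt_trans a1.
Qed.

(** Rescaling by [s] turns the hypothesis into a bound on the coefficients of [g]. The difference is
    [g] at [s^-1] without its constant term, and each remaining term carries a factor [s^-1]. *)
Lemma schwarz_poly (f : {poly K}) (M : R) (s : K) : 1 <= absv s ->
  (forall t, absv t <= absv s -> absv f.[t] <= M) ->
  absv (f.[1] - f.[0]) <= M / absv s.
Proof.
move=> s1 hf.
have s0 : s != 0 by rewrite -(absv_gt0 abs) (lt_le_trans ltr01).
have abs0 : 0 < absv s by rewrite (absv_gt0 abs).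
pose g := f \Po (s *: 'X).
have gE t : g.[t] = f.[s * t] by rewrite horner_comp hornerZ hornerX.
have hg : forall k, absv g`_k <= M.
  apply: coef_le_of_bounded => t t1; rewrite gE; apply: hf.
  by rewrite (absvM abs) ler_piMr // (absv_ge0 abs).
have M0 : 0 <= M by apply: le_trans (hg 0); apply: absv_ge0.
rewrite -[1](mulfV s0) -gE -[X in f.[X]](mulr0 s) -gE horner_coef0.
(* The extra unit of width lets the constant term split off even when [g] is zero. *)
rewrite (@horner_coef_wide _ (size g).+1) // big_ord_recl expr0 mulr1 addrAC subrr add0r.
apply: (absv_sum_le abs) => [|i _]; first by rewrite divr_ge0 // (absv_ge0 abs).
rewrite (absvM abs) ler_pM ?(absv_ge0 abs) // (absvX abs) (absvV abs) lift0 exprS.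
by rewrite ler_piMr ?invr_ge0 ?(absv_ge0 abs) // exprn_ile1 ?invr_ge0 ?(absv_ge0 abs) // invf_le1.
Qed.

End GaussNorm.

(** * The chordal metric and affine charts *)

Section ChordalGeometry.
Variables (R : realType) (K : closedFieldType) (absv : K -> R).
Hypothesis abs : nonarch_abs absv.
Variable N : nat.
Implicit Types x y z : vec K N.

Local Notation "`| x |v" := (vnorm absv x) (format "`| x |v").
Local Notation delta := (chordal absv).

Lemma bigmax_ord_le m (F : 'I_m -> R) B : 0 <= B -> (forall i, F i <= B) ->
  \big[Num.max/0]_(j < m) F j <= B.
Proof. by move=> B0 h; apply: bigmax_le => // i _. Qed.

Lemma vnorm_ge0 x : 0 <= `|x|v.
Proof. by apply: (le_trans (absv_ge0 abs (x ord0))); exact: le_bigmax. Qed.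

Lemma absv_le_vnorm x i : absv (x i) <= `|x|v. Proof. exact: le_bigmax. Qed.

Lemma vnorm_le x B : (forall i, absv (x i) <= B) -> `|x|v <= B.
Proof.
move=> h; apply: bigmax_ord_le => //.
by rewrite (le_trans _ (h ord0)) // (absv_ge0 abs).
Qed.

Lemma vnorm_attained x : exists i, absv (x i) = `|x|v.
Proof.
have [|i _ hi] := eq_bigmax (x := 0) ord0 xpredT (fun i => absv (x i)) isT.
  by move=> i _; apply: absv_ge0.
by exists i.
Qed.

Lemma vnorm_gt0 x : nonzero x -> 0 < `|x|v.
Proof.
by case=> i xi; rewrite (lt_le_trans _ (absv_le_vnorm x i)) // (absv_gt0 abs).
Qed.

Lemma nonzero_of_vnorm x : 0 < `|x|v -> nonzero x.
Proof.
by have [i <-] := vnorm_attained x; rewrite (absv_gt0 abs); exists i.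
Qed.

Definition vscale (a : K) x : vec K N := fun i => a * x i.
Definition vsub x y : vec K N := fun i => x i - y i.

Lemma vnorm_scale a x : `|vscale a x|v = absv a * `|x|v.
Proof.
apply/eqP; rewrite eq_le; apply/andP; split.
  by apply: vnorm_le => i; rewrite (absvM abs) ler_wpM2l ?(absv_ge0 abs) ?absv_le_vnorm.
by have [i <-] := vnorm_attained x; rewrite -(absvM abs); apply: absv_le_vnorm.
Qed.

Lemma nonzero_scale a x : a != 0 -> nonzero x -> nonzero (vscale a x).
Proof. by move=> a0 [i xi]; exists i; rewrite mulf_neq0. Qed.

Lemma vscaleK a x : a != 0 -> vscale a (vscale a^-1 x) = x.
Proof. by move=> a0; apply/funext => i; rewrite /vscale mulrA divff // mul1r. Qed.

Lemma vsubC_norm x y : `|vsub x y|v = `|vsub y x|v.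
Proof. by apply: eq_bigr => i _; apply: absvBC. Qed.

Lemma vnorm_sub_eq x y : `|vsub x y|v < `|x|v -> `|y|v = `|x|v.
Proof.
move=> h; apply/eqP; rewrite eq_le; apply/andP; split.
  apply: vnorm_le => i; rewrite -(subrK (x i) (y i)); apply: (absvD_le abs).
    by rewrite (absvBC abs) (le_trans _ (ltW h)) // (absv_le_vnorm (vsub x y)).
  exact: absv_le_vnorm.
have [i hi] := vnorm_attained x; rewrite -hi.
have hd : absv (x i - y i) < absv (- x i).
  by rewrite (absvN abs) hi (le_lt_trans _ h) // (absv_le_vnorm (vsub x y)).
have : absv (y i) = absv (- x i).
  by rewrite -(absvD_eqr abs hd) addrAC subrr add0r (absvN abs).
by rewrite (absvN abs) => <-; apply: absv_le_vnorm.
Qed.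

(** The sup norm of the exterior product of [x] and [y], the numerator of [chordal]. *)
Definition wedge x y : R :=
  \big[Num.max/0]_(i < N.+1) \big[Num.max/0]_(j < N.+1) absv (x i * y j - x j * y i).

Lemma chordalE x y : delta x y = wedge x y / (`|x|v * `|y|v). Proof. by []. Qed.

Lemma wedge_ge x y i j : absv (x i * y j - x j * y i) <= wedge x y.
Proof.
apply: le_trans (le_bigmax 0 (fun i => \big[Num.max/0]_(j < N.+1) _) i).
exact: (le_bigmax 0 (fun j => absv (x i * y j - x j * y i)) j).
Qed.

Lemma wedge_le x y B : (forall i j, absv (x i * y j - x j * y i) <= B) -> wedge x y <= B.
Proof.
move=> h; have B0 : 0 <= B by apply: le_trans (h ord0 ord0); apply: absv_ge0.
by apply: bigmax_ord_le => // i; apply: bigmax_ord_le.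
Qed.

Lemma wedge_ge0 x y : 0 <= wedge x y.
Proof. by apply: le_trans (wedge_ge x y ord0 ord0); apply: absv_ge0. Qed.

Lemma chordal_ge0 x y : 0 <= delta x y.
Proof. by rewrite chordalE divr_ge0 ?wedge_ge0 // mulr_ge0 ?vnorm_ge0. Qed.

Lemma wedgeC x y : wedge x y = wedge y x.
Proof.
apply: eq_bigr => i _; apply: eq_bigr => j _; rewrite -(absvN abs); congr absv; ring.
Qed.

Lemma chordalC x y : delta x y = delta y x.
Proof. by rewrite !chordalE wedgeC [_ * `|y|v]mulrC. Qed.

Lemma wedge_scalel a x y : wedge (vscale a x) y = absv a * wedge x y.
Proof.
have E i j : vscale a x i * y j - vscale a x j * y i = a * (x i * y j - x j * y i).
  by rewrite /vscale; ring.
apply/eqP; rewrite eq_le; apply/andP; split.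
  by apply: wedge_le => i j; rewrite E (absvM abs) ler_wpM2l ?(absv_ge0 abs) ?wedge_ge.
have [->|a0] := eqVneq a 0; first by rewrite (absv0 abs) mul0r wedge_ge0.
have a1 : 0 < absv a by rewrite (absv_gt0 abs).
rewrite mulrC -ler_pdivlMr //; apply: wedge_le => i j.
by rewrite ler_pdivlMr // mulrC -(absvM abs) -E wedge_ge.
Qed.

Lemma chordal_scalel a x y : a != 0 -> delta (vscale a x) y = delta x y.
Proof.
move=> a0; rewrite !chordalE wedge_scalel vnorm_scale -(mulrA _ `|x|v) -mulf_div divff ?mul1r //.
by rewrite (absv_eq0 abs).
Qed.

Lemma chordal_scaler a x y : a != 0 -> delta x (vscale a y) = delta x y.
Proof. by move=> a0; rewrite chordalC chordal_scalel // chordalC. Qed.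

Lemma chordalxx x : delta x x = 0.
Proof.
rewrite chordalE (_ : wedge x x = 0) ?mul0r //; apply/eqP; rewrite eq_le wedge_ge0 andbT.
by apply: wedge_le => i j; rewrite mulrC subrr (absv0 abs).
Qed.

(** Multiplied by a maximal coordinate of [y], a minor of [x] and [z] becomes a combination of
    minors of [x], [y] and of [y], [z]. *)
Lemma chordal_ultra x y z : nonzero x -> nonzero y -> nonzero z ->
  delta x z <= Num.max (delta x y) (delta y z).
Proof.
move=> /vnorm_gt0 x0 /vnorm_gt0 y0 /vnorm_gt0 z0.
rewrite !chordalE; set M := Num.max _ _.
have hxy : wedge x y <= M * (`|x|v * `|y|v).
  by rewrite -ler_pdivrMr ?mulr_gt0 // le_max lexx.
have hyz : wedge y z <= M * (`|y|v * `|z|v).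
  by rewrite -ler_pdivrMr ?mulr_gt0 // le_max lexx orbT.
rewrite ler_pdivrMr ?mulr_gt0 //.
have [k hk] := vnorm_attained y.
rewrite -(ler_pM2l y0); move: (y0); rewrite -{1 2}hk => k0.
rewrite mulrC -ler_pdivlMr //; apply: wedge_le => i j.
rewrite ler_pdivlMr // mulrC -(absvM abs).
(* a Pluecker-type relation *)
have -> : y k * (x i * z j - x j * z i) = z j * (x i * y k - x k * y i)
    - z i * (x j * y k - x k * y j) + x k * (y i * z j - y j * z i) by ring.
have hw (a : K) w (b c : R) : absv a <= b -> absv w <= M * c ->
  absv (a * w) <= M * (b * c).
  move=> ha hw; rewrite (absvM abs) mulrCA ler_pM ?(absv_ge0 abs) //.
have X : `|y|v * (M * (`|x|v * `|z|v)) = M * (`|z|v * (`|x|v * `|y|v)) by ring.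
have Y : `|y|v * (M * (`|x|v * `|z|v)) = M * (`|x|v * (`|y|v * `|z|v)) by ring.
apply: (absvD_le abs); last first.
  by rewrite Y; apply: hw; rewrite ?absv_le_vnorm // (le_trans _ hyz) // wedge_ge.
by rewrite X; apply: (absvB_le abs); apply: hw;
  rewrite ?absv_le_vnorm // (le_trans _ hxy) // wedge_ge.
Qed.

(** The minors with second index [i] are the coordinate differences; the others are combinations of
    these with coefficients of absolute value at most 1. *)
Lemma chordal_chart x y i : x i = 1 -> y i = 1 -> `|x|v = 1 -> `|y|v = 1 ->
  delta x y = `|vsub x y|v.
Proof.
move=> xi yi x1 y1; rewrite chordalE x1 y1 mulr1 divr1.
apply/eqP; rewrite eq_le; apply/andP; split.
  apply: wedge_le => a b.
  rewrite (_ : _ - _ = x b * (x a - y a) - x a * (x b - y b)); last by ring.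
  by apply: (absvB_le abs); rewrite (absvM abs) -[X in _ <= X]mul1r ler_pM ?(absv_ge0 abs) //;
    rewrite -?x1 ?absv_le_vnorm // (absv_le_vnorm (vsub x y)).
apply: vnorm_le => j; apply: le_trans (wedge_ge x y j i).
by rewrite xi yi mulr1 mul1r.
Qed.

(** The minors of [y] and [z] are those of [y] and [z - y], so the norm of [y] cancels. *)
Lemma chordal_le_sub y z : nonzero y -> nonzero z ->
  delta y z <= `|vsub z y|v / `|z|v.
Proof.
move=> /vnorm_gt0 y0 /vnorm_gt0 z0; rewrite chordalE invfM mulrA ler_pM2r ?invr_gt0 //.
rewrite ler_pdivrMr // mulrC; apply: wedge_le => i j.
rewrite (_ : _ - _ = y i * (z j - y j) - y j * (z i - y i)); last by ring.
by apply: (absvB_le abs); rewrite (absvM abs) ler_pM ?(absv_ge0 abs) ?absv_le_vnorm //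
  (absv_le_vnorm (vsub z y)).
Qed.

(** If [y i] were not maximal, the minor of [i] and a maximal coordinate [j] would be dominated by
    [x i * y j], forcing distance at least 1. *)
Lemma chordal_lt1_chart x y i : x i = 1 -> `|x|v = 1 -> nonzero y ->
  delta x y < 1 -> absv (y i) = `|y|v.
Proof.
move=> xi x1 y0; have y1 := vnorm_gt0 y0.
rewrite chordalE x1 mul1r ltr_pdivrMr // mul1r => h.
apply/eqP; rewrite eq_le absv_le_vnorm /= leNgt; apply/negP => hi.
have [j hj] := vnorm_attained y.
have h1 : absv (x j * y i) < `|y|v.
  rewrite (absvM abs) (le_lt_trans _ hi) // ler_piMl ?(absv_ge0 abs) //.
  by rewrite -x1 absv_le_vnorm.
have h2 : absv (x i * y j - x j * y i) < `|y|v by apply: le_lt_trans h; apply: wedge_ge.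
by have := absvD_lt abs h2 h1; rewrite subrK xi mul1r hj ltxx.
Qed.

Definition normalize i x : vec K N := vscale (x i)^-1 x.

Lemma normalizeP i x : nonzero x -> absv (x i) = `|x|v ->
  [/\ x i != 0, normalize i x i = 1 & `|normalize i x|v = 1].
Proof.
move=> /vnorm_gt0 x0 hi; have xi : x i != 0 by rewrite -(absv_gt0 abs) hi.
split => //; first by rewrite /normalize /vscale mulVf.
by rewrite vnorm_scale (absvV abs) hi mulVf ?gt_eqF.
Qed.

Lemma common_chart x y : nonzero x -> nonzero y -> delta x y < 1 ->
  forall i, absv (x i) = `|x|v -> absv (y i) = `|y|v.
Proof.
move=> x0 y0 h i hi; have [xi x'i x'1] := normalizeP x0 hi.
apply: (chordal_lt1_chart x'i x'1 y0).
by rewrite chordal_scalel // invr_neq0.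
Qed.

Lemma chordal_ball_open x r : nonzero x -> chordal_open absv (fun z : vec K N => delta x z < r).
Proof.
move=> x0 y y0 hy; exists r; split; first exact: le_lt_trans (chordal_ge0 x y) hy.
by move=> z z0 hz; rewrite (le_lt_trans (chordal_ultra x0 y0 z0)) // gt_max hy.
Qed.

End ChordalGeometry.

(** * Polynomial maps on polydiscs and their restriction to lines *)

Section PolynomialMaps.
Variables (R : realType) (K : closedFieldType) (absv : K -> R).
Hypothesis abs : nonarch_abs absv.
Variable N : nat.
Implicit Types (x y z : vec K N) (p : mpoly N.+1 K).

Local Notation "`| x |v" := (vnorm absv x) (format "`| x |v").
Local Notation delta := (chordal absv).

Lemma meval_bounded p : exists2 B, 0 < B &
  forall x, `|x|v <= 1 -> absv (meval x p) <= B.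
Proof.
have s0 (s : seq (multinom N.+1)) : 0 <= \sum_(m <- s) absv (mcoeff m p).
  by apply: sumr_ge0 => m _; apply: absv_ge0.
(* The summand 1 keeps the bound positive when [p] is zero. *)
exists (1 + \sum_(m <- msupp p) absv (mcoeff m p)); first by rewrite ltr_pwDl.
move=> x x1; rewrite mevalE big_seq; apply: (absv_sum_le abs) => [|m mp].
  by rewrite addr_ge0.
rewrite (absvM abs) (absv_prod abs).
have h : \prod_i absv (x i ^+ m i) <= 1.
  apply: prodr_ile1 => i _; rewrite (absv_ge0 abs) (absvX abs) exprn_ile1 ?(absv_ge0 abs) //.
  by rewrite (le_trans _ x1) // absv_le_vnorm.
rewrite (le_trans (ler_wpM2l (absv_ge0 abs _) h)) // mulr1 (big_rem m) //=.
by rewrite addrCA lerDl addr_ge0.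
Qed.

Lemma meval_vscale d p a x : homog_deg d p ->
  meval (vscale a x) p = a ^+ d * meval x p.
Proof.
move=> /allP hp; rewrite !mevalE mulr_sumr; apply: eq_big_seq => m /hp /eqP <-.
rewrite mulrCA; congr (_ * _); rewrite mdegE expr_sum -big_split /=.
by apply: eq_bigr => i _; rewrite exprMn.
Qed.

Definition vline y z (t : K) : vec K N := fun i => y i + t * (z i - y i).

Lemma vline0 y z : vline y z 0 = y.
Proof. by apply/funext => i; rewrite /vline mul0r addr0. Qed.

Lemma vline1 y z : vline y z 1 = z.
Proof. by apply/funext => i; rewrite /vline mul1r addrC subrK. Qed.

Lemma poly_meval (f : K -> vec K N) p :
  (forall i, exists q : {poly K}, forall t, f t i = q.[t]) ->
  exists q : {poly K}, forall t, meval (f t) p = q.[t].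
Proof.
move=> /choice [q hq].
exists (\sum_(m <- msupp p) (mcoeff m p)%:P * \prod_i q i ^+ m i) => t.
rewrite mevalE horner_sum; apply: eq_bigr => m _.
rewrite hornerM hornerC horner_prod; congr (_ * _); apply: eq_bigr => i _.
by rewrite horner_exp hq.
Qed.

Lemma poly_iterPhi_vline (Phi : 'I_N.+1 -> mpoly N.+1 K) y z n i :
  exists q : {poly K}, forall t, iterPhi Phi n (vline y z t) i = q.[t].
Proof.
elim: n i => [|n IH] i; last exact: poly_meval.
exists ((y i)%:P + 'X * (z i - y i)%:P) => t.
by rewrite hornerD hornerM hornerX !hornerC.
Qed.

(** Schwarz's lemma in several variables, by restriction to the line through [y] and [z]. *)
Lemma schwarz_vline (F : vec K N -> K) y z (rho : K) (M : R) :
  (exists q : {poly K}, forall t, F (vline y z t) = q.[t]) ->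
  rho != 0 -> `|vsub z y|v <= absv rho ->
  (forall t, absv t * `|vsub z y|v <= absv rho -> absv (F (vline y z t)) <= M) ->
  absv (F z - F y) <= M / absv rho * `|vsub z y|v.
Proof.
move=> [q hq] rho0 hyz hF.
have rho1 : 0 < absv rho by rewrite (absv_gt0 abs).
have [k hk] := vnorm_attained abs (vsub z y).
have [u0|u0] := eqVneq (vsub z y k) 0.
  have -> : z = y.
    apply/funext => i; apply/eqP; rewrite -subr_eq0 -(absv_eq0 abs) eq_le (absv_ge0 abs) andbT.
    by rewrite -(absv0 abs) -u0 hk (absv_le_vnorm absv (vsub z y)).
  rewrite subrr (absv0 abs) mulr_ge0 ?(vnorm_ge0 abs) // divr_ge0 ?(absv_ge0 abs) //.
  apply: le_trans (hF 0 _); first exact: absv_ge0.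
  by rewrite (absv0 abs) mul0r ltW.
have u1 : 0 < absv (vsub z y k) by rewrite (absv_gt0 abs).
(* Dividing by the maximal coordinate [k] realizes the real radius of the parameter disc as the
   absolute value of an element of [K]. *)
have hs : absv (rho / vsub z y k) = absv rho / `|vsub z y|v.
  by rewrite (absvM abs) (absvV abs) hk.
rewrite -{1}(vline1 y z) -{2}(vline0 y z) !hq.
have := @schwarz_poly R K absv abs q M (rho / vsub z y k).
rewrite hs -hk ler_pdivlMr // mul1r hk => /(_ hyz).
rewrite invf_div mulrAC mulrA; apply => t ht.
by rewrite -hq; apply: hF; rewrite -ler_pdivlMr // -hk.
Qed.

End PolynomialMaps.

(** * Homogeneity and size estimates for the lift *)

Section Dynamics.
Variables (R : realType) (K : closedFieldType) (absv : K -> R).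
Hypothesis hK : nonarch_complete_field absv.
Variables (N d : nat) (Phi : 'I_N.+1 -> mpoly N.+1 K).
Hypothesis d2 : (2 <= d)%N.
Hypothesis hPhi : is_lift d Phi.
Implicit Types (x y z : vec K N).

Local Notation "`| x |v" := (vnorm absv x) (format "`| x |v").
Local Notation delta := (chordal absv).
Local Notation f := (evalPhi Phi).
Local Notation fn := (iterPhi Phi).

Let abs : nonarch_abs absv. Proof. by have [] := hK. Qed.

Lemma ler_sum_ord m (F : 'I_m -> R) : (forall i, 0 < F i) -> forall i, F i <= \sum_j F j.
Proof.
by move=> F0 i; rewrite (bigD1 i) //= lerDl sumr_ge0 // => j _; apply: ltW.
Qed.

Lemma evalPhi_vscale a x : f (vscale a x) = vscale (a ^+ d) (f x).
Proof.
apply/funext => i; rewrite /evalPhi (meval_vscale _ _ (d := d)) //.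
by have [h _] := hPhi; apply: h.
Qed.

Lemma iterPhi_vscale n a x : a != 0 ->
  exists2 b, b != 0 & fn n (vscale a x) = vscale b (fn n x).
Proof.
move=> a0; elim: n => [|n [b b0 IH]]; first by exists a.
exists (b ^+ d); first by rewrite expf_neq0.
by rewrite /iterPhi /= -/(fn n _) IH evalPhi_vscale.
Qed.

Lemma chordal_iterPhi_vscale n a b y z : a != 0 -> b != 0 ->
  delta (fn n (vscale a y)) (fn n (vscale b z)) = delta (fn n y) (fn n z).
Proof.
move=> /(iterPhi_vscale n y) [a' a0 ->] /(iterPhi_vscale n z) [b' b0 ->].
by rewrite (chordal_scalel abs) // (chordal_scaler abs).
Qed.

(** Reduces size estimates to vectors of norm 1. The division is by a maximal coordinate because the
    norm is a real number, not a scalar of [K]. *)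
Lemma vnorm_evalPhi_normalize x : nonzero x ->
  exists i, absv (x i) = `|x|v /\ `|f x|v = `|x|v ^+ d * `|f (normalize i x)|v.
Proof.
move=> x0; have [i hi] := vnorm_attained abs x; exists i; split => //.
have [xi _ _] := normalizeP abs x0 hi.
rewrite -{1}(vscaleK x xi) -/(normalize i x) evalPhi_vscale (vnorm_scale abs).
by rewrite (absvX abs) hi.
Qed.

Lemma vnorm_evalPhi_le : exists2 C, 0 < C & forall x, nonzero x -> `|f x|v <= C * `|x|v ^+ d.
Proof.
have /choice [B hB] : forall i, exists B, 0 < B /\
    forall x, `|x|v <= 1 -> absv (meval x (Phi i)) <= B.
  by move=> i; have [B B0 h] := meval_bounded abs (Phi i); exists B.
have B0 i : 0 < B i by have [] := hB i.
exists (\sum_i B i); first by rewrite (lt_le_trans (B0 ord0)) ?ler_sum_ord.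
move=> x x0; have [i [hi ->]] := vnorm_evalPhi_normalize x0.
rewrite mulrC ler_wpM2r ?exprn_ge0 ?(vnorm_ge0 abs) //.
have [_ _ x1] := normalizeP abs x0 hi.
apply: (vnorm_le abs) => j; have [_ h] := hB j.
by rewrite (le_trans (h _ _)) ?x1 ?ler_sum_ord.
Qed.

(* Apply the Nullstellensatz to [Phi] together with [X_i - 1] and evaluate the resulting
   identity at a vector whose largest coordinate is [x i = 1]. *)
Lemma vnorm_evalPhi_ge : exists2 c, 0 < c & forall x, nonzero x -> c * `|x|v ^+ d <= `|f x|v.
Proof.
have [_ ntriv compl] := hK.
have /choice [B hB] : forall i : 'I_N.+1, exists B, 0 < B /\
    forall x, x i = 1 -> `|x|v = 1 -> 1 <= B * `|f x|v.
  move=> i.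
  pose g (t : option 'I_N.+1) := if t is Some j then Phi j else mpolyX K (mnm1 i) - 1.
  have [x|a ha] := weak_nullstellensatz (infinite_in_countable_cover abs ntriv compl) (f := g).
    have [xi|xi] := eqVneq (x i) 1; last first.
      by exists None; rewrite mevalB mevalXU meval1 subr_eq0.
    apply: contrapT => no; have [_ hx] := hPhi.
    have : x i = 0.
      apply: hx => j; apply/eqP; rewrite -[_ == _]negbK; apply/negP => hj.
      by apply: no; exists (Some j).
    by rewrite xi => /eqP; rewrite oner_eq0.
  have /choice [B hB] : forall j, exists B, 0 < B /\
      forall x, `|x|v <= 1 -> absv (meval x (a (Some j))) <= B.
    by move=> j; have [B B0 h] := meval_bounded abs (a (Some j)); exists B.
  have B0 j : 0 < B j by have [] := hB j.
  exists (\sum_j B j); split; first by rewrite (lt_le_trans (B0 ord0)) ?ler_sum_ord.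
  move=> x xi x1; rewrite -{1}(absv1 abs) -(meval1 x) -ha raddf_sum /=.
  apply: (absv_sum_le abs) => [|[j|] _].
  - by rewrite mulr_ge0 ?(vnorm_ge0 abs) ?sumr_ge0 // => j _; apply: ltW.
  - rewrite mevalM (absvM abs) ler_pM ?(absv_ge0 abs) //.
      by have [_ h] := hB j; rewrite (le_trans (h _ _)) ?x1 ?ler_sum_ord.
    exact: (absv_le_vnorm absv (f x)).
  - rewrite mevalM /= mevalB mevalXU meval1 xi subrr mulr0 (absv0 abs).
    by rewrite mulr_ge0 ?(vnorm_ge0 abs) ?sumr_ge0 // => j _; apply: ltW.
have B0 i : 0 < B i by have [] := hB i.
have S0 : 0 < \sum_i B i by rewrite (lt_le_trans (B0 ord0)) ?ler_sum_ord.
exists (\sum_i B i)^-1; first by rewrite invr_gt0.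
move=> x x0; have [i [hi ->]] := vnorm_evalPhi_normalize x0.
rewrite mulrC ler_wpM2l ?exprn_ge0 ?(vnorm_ge0 abs) //.
have [_ xi x1] := normalizeP abs x0 hi.
rewrite -[X in X <= _]mulr1 ler_pdivrMl //.
have [_ h] := hB i; rewrite (le_trans (h _ xi x1)) // ler_wpM2r ?(vnorm_ge0 abs) //.
exact: ler_sum_ord.
Qed.

(** Schwarz's lemma with [rho = 1]: for parameters in the disc that it requires, the line through
    two points of the unit polydisc stays in that polydisc, where each [Phi i] is bounded. *)
Lemma evalPhi_lipschitz : exists2 A, 0 < A &
  forall y z, `|y|v <= 1 -> `|z|v <= 1 -> `|vsub (f z) (f y)|v <= A * `|vsub z y|v.
Proof.
have /choice [B hB] : forall i, exists B, 0 < B /\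
    forall x, `|x|v <= 1 -> absv (meval x (Phi i)) <= B.
  by move=> i; have [B B0 h] := meval_bounded abs (Phi i); exists B.
have B0 i : 0 < B i by have [] := hB i.
exists (\sum_i B i); first by rewrite (lt_le_trans (B0 ord0)) ?ler_sum_ord.
move=> y z y1 z1; apply: (vnorm_le abs) => i.
have zy : `|vsub z y|v <= 1.
  by apply: (vnorm_le abs) => j; apply: (absvB_le abs);
    rewrite (le_trans (absv_le_vnorm absv _ _)).
have := @schwarz_vline R K absv abs N (fun x => meval x (Phi i)) y z 1 (B i).
rewrite (absv1 abs) divr1 oner_eq0 => h.
apply: le_trans (h _ isT zy _) _.
(* The coordinates of the line itself are the case of the zeroth iterate. *)
- by apply: poly_meval => j; apply: (poly_iterPhi_vline Phi y z 0).
- move=> t t1; have [_ hb] := hB i; apply: hb; apply: (vnorm_le abs) => j.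
  apply: (absvD_le abs); first by rewrite (le_trans (absv_le_vnorm absv _ _)).
  rewrite (absvM abs) (le_trans _ t1) // ler_wpM2l ?(absv_ge0 abs) //.
  exact: (absv_le_vnorm absv (vsub z y)).
- by rewrite ler_wpM2r ?(vnorm_ge0 abs) // ler_sum_ord.
Qed.

Lemma nonzero_evalPhi x : nonzero x -> nonzero (f x).
Proof.
have [c c0 hc] := vnorm_evalPhi_ge => x0.
apply: (nonzero_of_vnorm abs); apply: lt_le_trans (hc x x0).
by rewrite mulr_gt0 // exprn_gt0 // (vnorm_gt0 abs).
Qed.

Lemma nonzero_iterPhi n x : nonzero x -> nonzero (fn n x).
Proof. by move=> x0; elim: n => // n; apply: nonzero_evalPhi. Qed.

(** Distance below 1 gives a common chart, where the ratio is the norm of [Phi] at the normalized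
    vector and is at least [c]. Distance below [c / A] moves that value by less than its norm, which
    therefore does not change. *)
Lemma vnorm_ratio_locally_constant : exists2 e, 0 < e &
  forall y z, nonzero y -> nonzero z -> delta y z < e ->
    `|f y|v / `|y|v ^+ d = `|f z|v / `|z|v ^+ d.
Proof.
have [c c0 hc] := vnorm_evalPhi_ge; have [A A0 hA] := evalPhi_lipschitz.
exists (Num.min 1 (c / A)); first by rewrite lt_min ltr01 divr_gt0.
move=> y z y0 z0; rewrite lt_min => /andP[h1 hcA].
have [i hy] := vnorm_attained abs y; have hz := common_chart abs y0 z0 h1 hy.
have [yi y'i y1] := normalizeP abs y0 hy; have [zi z'i z1] := normalizeP abs z0 hz.
have ratio x : nonzero x -> x i != 0 -> absv (x i) = `|x|v ->
    `|f x|v / `|x|v ^+ d = `|f (normalize i x)|v.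
  move=> x0 xi hx; rewrite -{1}(vscaleK x xi) -/(normalize i x) evalPhi_vscale.
  rewrite (vnorm_scale abs) (absvX abs) hx mulrAC divff ?mul1r //.
  by rewrite expf_neq0 // gt_eqF // (vnorm_gt0 abs).
rewrite !ratio //; apply: (vnorm_sub_eq abs).
apply: le_lt_trans (hA _ _ _ _) _; rewrite ?y1 ?z1 //.
rewrite -(chordal_chart abs z'i y'i z1 y1) (chordal_scalel abs) ?invr_neq0 //.
rewrite (chordal_scaler abs) ?invr_neq0 // (chordalC abs) mulrC -ltr_pdivlMr //.
apply: lt_le_trans hcA _; rewrite ler_pM2r ?invr_gt0 //.
have z'0 : nonzero (normalize i z) by apply: nonzero_scale; rewrite ?invr_neq0.
by have := hc _ z'0; rewrite z1 expr1n mulr1.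
Qed.

Lemma ln_evalPhi_bound : exists2 B, 0 <= B & forall x, nonzero x ->
  `|ln `|f x|v - d%:R * ln `|x|v| <= B.
Proof.
have [c c0 hc] := vnorm_evalPhi_ge; have [C C0 hC] := vnorm_evalPhi_le.
exists (`|ln c| + `|ln C|); first by rewrite addr_ge0.
move=> x x0; have x1 := vnorm_gt0 abs x0; have fx1 := vnorm_gt0 abs (nonzero_evalPhi x0).
have xd : 0 < `|x|v ^+ d by rewrite exprn_gt0.
have lnd : ln (`|x|v ^+ d) = d%:R * ln `|x|v by rewrite lnXn // mulr_natl.
have h1 : ln c + d%:R * ln `|x|v <= ln `|f x|v.
  by rewrite -lnd -lnM ?posrE // ler_ln ?posrE ?mulr_gt0 // hc.
have h2 : ln `|f x|v <= ln C + d%:R * ln `|x|v.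
  by rewrite -lnd -lnM ?posrE // ler_ln ?posrE ?mulr_gt0 // hC.
have := ler_norm (ln C); have := ler_norm (- ln c); rewrite normrN.
have := normr_ge0 (ln c); have := normr_ge0 (ln C).
by rewrite ler_norml => *; apply/andP; split; lra.
Qed.

(** * The Green function and its distance to the iterates *)

Local Notation lam x n := (ln (vnorm absv (fn n x)) / (d%:R ^+ n)).

Let d0 : 0 < (d%:R : R). Proof. by rewrite ltr0n (leq_trans _ d2). Qed.

Let dn0 n : 0 < (d%:R : R) ^+ n. Proof. exact: exprn_gt0. Qed.

(** Successive terms differ by at most [e n.+1], so [lam - e] increases and [lam + e] decreases.
    They squeeze the limit to within [e n] of the [n]-th term; multiplying by [d ^ n] gives the
    uniform bound [B]. *)
Lemma green_cvg_bound : exists2 B, 0 <= B & forall x, nonzero x ->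
  cvgn (fun n => lam x n) /\
  forall n, `|ln `|fn n x|v - d%:R ^+ n * green absv d Phi x| <= B.
Proof.
have [B B0 hB] := ln_evalPhi_bound; exists B => // x x0.
pose e n : R := B / d%:R ^+ n.
have e0 n : 0 <= e n by rewrite divr_ge0 // ltW.
(* This says [2 * e n.+1 <= e n], the place where [d >= 2] makes both sequences monotone. *)
have eS n : e n.+1 <= e n - e n.+1.
  have h : e n.+1 = e n / d%:R by rewrite /e exprSr invfM mulrA.
  rewrite lerBrDr -mulr2n h -[_ *+ 2]mulr_natr mulrAC ler_pdivrMr // ler_wpM2l //.
  by rewrite ler_nat.
have step n : `|lam x n.+1 - lam x n| <= e n.+1.
  have -> : lam x n.+1 - lam x n = (ln `|f (fn n x)|v - d%:R * ln `|fn n x|v) / d%:R ^+ n.+1.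
    rewrite exprS /iterPhi /=.
    by field; rewrite !gt_eqF.
  rewrite /e normrM normfV [X in _ / X]ger0_norm ?(ltW (dn0 _)) //.
  rewrite ler_pM2r ?invr_gt0 //.
  by apply/hB/nonzero_iterPhi.
have lowS n : lam x n - e n <= lam x n.+1 - e n.+1.
  by have := step n; have := eS n; rewrite ler_norml => ? /andP[]; lra.
have upS n : lam x n.+1 + e n.+1 <= lam x n + e n.
  by have := step n; have := eS n; rewrite ler_norml => ? /andP[]; lra.
have low_mono : {homo (fun n => lam x n - e n) : n m / (n <= m)%N >-> n <= m}.
  exact/nondecreasing_seqP.
have up_mono : {homo (fun n => lam x n + e n) : n m / (n <= m)%N >-> n >= m}.
  exact/nonincreasing_seqP.
have ecvg : e @ \oo --> (0 : R).
  rewrite -(mulr0 B); apply: cvgM; first exact: cvg_cst.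
  have -> : (fun n => (d%:R ^+ n : R)^-1) = (fun n => (d%:R^-1) ^+ n).
    by apply/funext => n; rewrite exprVn.
  apply: cvg_expr; rewrite ger0_norm ?invr_ge0 ?ltW // invf_lt1 //.
  by rewrite ltr1n (leq_trans _ d2).
have low_cvg : cvgn (fun n => lam x n - e n).
  apply: nondecreasing_is_cvgn => //; exists (lam x 0%N + e 0%N) => _ [n _ <-].
  apply: le_trans (up_mono _ _ (leq0n n)).
  by rewrite lerD2l (le_trans _ (e0 n)) // oppr_le0.
have lam_cvg : cvgn (fun n => lam x n).
  have -> : (fun n => lam x n) = (fun n => lam x n - e n) \+ e.
    by apply/funext => n /=; rewrite subrK.
  by apply: is_cvgD => //; apply/cvg_ex; exists 0.
split => // n.
have low_lim : (fun n => lam x n - e n) @ \oo --> green absv d Phi x.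
  by rewrite -[green _ _ _ _]subr0; apply: cvgB.
have up_lim : (fun n => lam x n + e n) @ \oo --> green absv d Phi x.
  by rewrite -[green _ _ _ _]addr0; apply: cvgD.
have lo : lam x n - e n <= green absv d Phi x.
  by rewrite -(cvg_lim _ low_lim) //; apply: nondecreasing_cvgn_le.
have up : green absv d Phi x <= lam x n + e n.
  rewrite -(cvg_lim _ up_lim) //.
  by apply: (nonincreasing_cvgn_ge up_mono); apply/cvg_ex; exists (green absv d Phi x).
have -> : ln `|fn n x|v - d%:R ^+ n * green absv d Phi x =
    d%:R ^+ n * (lam x n - green absv d Phi x).
  by rewrite mulrBr [_ * (_ / _)]mulrC divfK // gt_eqF.
rewrite normrM ger0_norm ?(ltW (dn0 _)) // mulrC -ler_pdivlMr // -/(e n).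
by rewrite ler_norml; apply/andP; split; lra.
Qed.

(** * The implications between the three conditions *)

Lemma equicont_ghat_eq x : nonzero x -> equicont_at absv Phi x ->
  exists2 r, 0 < r & forall z, nonzero z -> delta x z < r ->
    ghat absv d Phi z = ghat absv d Phi x.
Proof.
move=> x0 eqc; have [e e0 he] := vnorm_ratio_locally_constant.
have [B B0 hB] := green_cvg_bound.
have [r [r0 hr]] := eqc e e0.
(* Equicontinuity controls the iterates from [n = 1] on; the bound [e] takes care of [n = 0]. *)
exists (Num.min r e); first by rewrite lt_min r0.
move=> z z0; rewrite lt_min => /andP[zr ze].
have close n : delta (fn n x) (fn n z) < e by case: n => [//|n]; apply: hr.
(* The increments of [lam] are the same for [x] and [z], so the two sequences keep their initial
   difference. *)
have hlam n : lam z n = lam x n + (ln `|z|v - ln `|x|v).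
  elim: n => [|n IH]; first by rewrite expr0 !divr1 addrC subrK.
  have step y : nonzero y -> lam y n.+1 =
      lam y n + ln (`|f (fn n y)|v / `|fn n y|v ^+ d) / d%:R ^+ n.+1.
    move=> y0; have yn := nonzero_iterPhi n y0.
    have y1 := vnorm_gt0 abs yn; have y2 := vnorm_gt0 abs (nonzero_evalPhi yn).
    rewrite ln_div ?posrE ?exprn_gt0 // lnXn // -mulr_natl exprS /iterPhi /=.
    by field; rewrite mulr1 !gt_eqF.
  rewrite (step z z0) (step x x0) IH.
  rewrite (he _ _ (nonzero_iterPhi n x0) (nonzero_iterPhi n z0) (close n)).
  exact: addrAC.
have [xcvg _] := hB x x0.
have hz : green absv d Phi z = green absv d Phi x + (ln `|z|v - ln `|x|v).
  rewrite /green (funext hlam : (fun n => lam z n) = _).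
  by apply: cvg_lim => //; apply: cvgD => //; apply: cvg_cst.
by rewrite /ghat hz addrA; lra.
Qed.

Lemma fatou_ghat_loc_const x : nonzero x -> in_fatou absv Phi x ->
  ghat_loc_const absv d Phi x.
Proof.
move=> x0 [U [_ Ux /(_ x x0 Ux) eqc]].
have [r r0 h] := equicont_ghat_eq x0 eqc.
exists (fun z => delta x z < r); split; first exact: chordal_ball_open.
  by rewrite (chordalxx abs).
by move=> y y0; apply: h.
Qed.

Lemma lipschitz_fatou x : nonzero x -> loc_unif_lipschitz absv Phi x -> in_fatou absv Phi x.
Proof.
move=> x0 [r [C [r0 C0 h]]].
exists (fun z => delta x z < r); split; first exact: chordal_ball_open.
  by rewrite (chordalxx abs).
(* By the ultrametric inequality, the bound [r] keeps [z] in the ball around [x] where the Lipschitz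
   estimate applies. *)
move=> y y0 xy e e0; exists (Num.min r (e / C)).
split=> [|z z0]; first by rewrite lt_min r0 divr_gt0.
rewrite lt_min => /andP[yz1 yz2] n _.
have xz : delta x z < r by rewrite (le_lt_trans (chordal_ultra abs x0 y0 z0)) // gt_max xy.
by rewrite (le_lt_trans (h _ _ y0 z0 (ltW xy) (ltW xz) n)) // mulrC -ltr_pdivlMr.
Qed.

(* Where the Green function is constant, all [|Phi^n|] are comparable to a constant
   on a polydisc, so Schwarz's lemma makes [Phi^n] Lipschitz relative to its size. *)
Lemma ghat_loc_const_lipschitz x : nonzero x -> ghat_loc_const absv d Phi x ->
  loc_unif_lipschitz absv Phi x.
Proof.
have [_ ntriv _] := hK; have [B B0 hB] := green_cvg_bound.
move=> x0 [U [Uopen Ux hU]]; have [r0 [r00 hr0]] := Uopen x x0 Ux.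
have m0 : 0 < Num.min 1 r0 by rewrite lt_min ltr01.
(* The bound 1 keeps the ball around [x] in one affine chart, and [r0] keeps it inside [U]. *)
have [rho rho0] := absv_small abs ntriv m0; rewrite lt_min => /andP[rho1 rhor].
have arho : 0 < absv rho by rewrite (absv_gt0 abs).
(* [expR (B + B)] is the ratio of the upper to the lower bound for the iterates below; the division
   by [absv rho] comes from Schwarz's lemma. *)
exists (absv rho), (expR (B + B) / absv rho).
split => // [|y z y0 z0 xy xz n]; first by rewrite divr_gt0 // expR_gt0.
have [i hx] := vnorm_attained abs x.
have hy := common_chart abs x0 y0 (le_lt_trans xy rho1) hx.
have hz := common_chart abs x0 z0 (le_lt_trans xz rho1) hx.
have [xi x'i x1] := normalizeP abs x0 hx.
have [yi y'i y1] := normalizeP abs y0 hy.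
have [zi z'i z1] := normalizeP abs z0 hz.
have xi' : (x i)^-1 != 0 by rewrite invr_neq0.
have yi' : (y i)^-1 != 0 by rewrite invr_neq0.
have zi' : (z i)^-1 != 0 by rewrite invr_neq0.
rewrite -(chordal_iterPhi_vscale n y z yi' zi') -(chordal_scalel abs y z yi').
rewrite -(chordal_scaler abs _ z zi') -/(normalize i y) -/(normalize i z).
have yx : `|vsub (normalize i y) (normalize i x)|v <= absv rho.
  rewrite -(chordal_chart abs y'i x'i y1 x1) (chordal_scalel abs) //.
  by rewrite (chordal_scaler abs) // (chordalC abs).
have zx : `|vsub (normalize i z) (normalize i x)|v <= absv rho.
  rewrite -(chordal_chart abs z'i x'i z1 x1) (chordal_scalel abs) //.
  by rewrite (chordal_scaler abs) // (chordalC abs).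
rewrite (chordalC abs (normalize i y) (normalize i z)) (chordal_chart abs z'i y'i z1 y1).
set x' := normalize i x in x'i x1 yx zx; set y' := normalize i y in y'i y1 yx *.
set z' := normalize i z in z'i z1 zx *.
have zy : `|vsub z' y'|v <= absv rho.
  apply: (vnorm_le abs) => j.
  rewrite (_ : vsub z' y' j = vsub z' x' j - vsub y' x' j); last by rewrite /vsub; ring.
  by apply: (absvB_le abs); apply: le_trans (absv_le_vnorm absv _ j) _.
(* Vectors of norm 1 satisfy [green = ghat], so throughout the polydisc the logarithm of the size of
   the [n]-th iterate is within [B] of [g]. *)
pose g := d%:R ^+ n * ghat absv d Phi x.
have chart w : w i = 1 -> `|vsub w x'|v <= absv rho ->
    [/\ nonzero w, `|fn n w|v <= expR (g + B) & expR (g - B) <= `|fn n w|v].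
  move=> wi wx; have w0 : nonzero w by exists i; rewrite wi oner_eq0.
  have w1 : `|w|v = 1.
    by rewrite -x1; apply: (vnorm_sub_eq abs); rewrite (vsubC_norm abs) x1 (le_lt_trans wx).
  have hg : ghat absv d Phi w = ghat absv d Phi x.
    apply: (hU w w0); apply: (hr0 w w0); apply: le_lt_trans rhor.
    rewrite -(chordal_scalel abs x w xi') (chordalC abs).
    by rewrite (chordal_chart abs wi x'i w1 x1).
  have := hB w w0 => -[_ /(_ n)].
  have -> : green absv d Phi w = ghat absv d Phi x by rewrite -hg /ghat w1 ln1 subr0.
  have fw := vnorm_gt0 abs (nonzero_iterPhi n w0).
  rewrite -/g ler_norml => /andP[h1 h2].
  have fwK : expR (ln `|fn n w|v) = `|fn n w|v by rewrite lnK ?posrE.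
  by split; rewrite // -fwK ler_expR; lra.
have [y'0 _ _] := chart y' y'i yx; have [z'0 _ fz] := chart z' z'i zx.
apply: le_trans (chordal_le_sub abs (nonzero_iterPhi n y'0) (nonzero_iterPhi n z'0)) _.
have fz0 := vnorm_gt0 abs (nonzero_iterPhi n z'0).
have fzy : `|vsub (fn n z') (fn n y')|v <= expR (g + B) / absv rho * `|vsub z' y'|v.
  apply: (vnorm_le abs) => j.
  apply: (schwarz_vline abs (F := fun w => fn n w j)) => //.
    exact: poly_iterPhi_vline.
  (* For these parameters the line keeps coordinate [i] equal to 1 and stays in the polydisc around
     [x'], so [chart] bounds the iterate there. *)
  move=> t ht; have [||_ h _] := chart (vline y' z' t).
  - by rewrite /vline y'i z'i subrr mulr0 addr0.
  - apply: (vnorm_le abs) => k.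
    rewrite (_ : vsub _ _ k = vsub y' x' k + t * vsub z' y' k); last first.
      by rewrite /vsub /vline; ring.
    apply: (absvD_le abs); first exact: le_trans (absv_le_vnorm absv _ k) _.
    rewrite (absvM abs) (le_trans _ ht) // ler_wpM2l ?(absv_ge0 abs) //.
    exact: absv_le_vnorm.
  - by apply: le_trans h; apply: absv_le_vnorm.
rewrite ler_pdivrMr // (le_trans fzy) //.
(* Here [g], the only quantity depending on [n], cancels. *)
have -> : expR (g + B) = expR (B + B) * expR (g - B) by rewrite -expRD; congr expR; ring.
rewrite [X in _ <= X]mulrAC [X in _ <= X * _]mulrAC ler_wpM2r ?(vnorm_ge0 abs) //.
by rewrite ler_wpM2r ?invr_ge0 ?(absv_ge0 abs) // ler_wpM2l ?expR_ge0.
Qed.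

End Dynamics.

Theorem theorem23 (R : realType) (K : closedFieldType) (absv : K -> R)
  (N d : nat) (Phi : 'I_N.+1 -> mpoly.mpoly N.+1 K) (x : 'I_N.+1 -> K) :
  nonarch_complete_field absv -> (2 <= d)%N -> is_lift d Phi -> nonzero x ->
  (in_fatou absv Phi x <-> loc_unif_lipschitz absv Phi x) /\
  (in_fatou absv Phi x <-> ghat_loc_const absv d Phi x).
Proof.
move=> hK d2 hPhi x0; split; split.
- by move=> /(fatou_ghat_loc_const hK d2 hPhi x0) /(ghat_loc_const_lipschitz hK d2 hPhi x0).
- exact: (lipschitz_fatou hK x0).
- exact: (fatou_ghat_loc_const hK d2 hPhi x0).
- by move=> /(ghat_loc_const_lipschitz hK d2 hPhi x0) /(lipschitz_fatou hK x0).
Qed.
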